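(* Assume $\lambda<1$. In a continuous SOS process with $\beta=\beta_{opt}=2/(1+\sqrt{1-\lambda^2})$, for every node $i$ and every round $t$ the transient load satisfies $$\breve{x}_i(t)\ \ge\ -O\left(\frac{\sqrt{n}\cdot\Delta(0)}{\sqrt{1-\lambda}}\right).$$
   Context: $G=(V,E)$ is a finite undirected graph with $V=\{1,\dots,n\}$, $n\ge2$; $N(i)$ is the set of neighbors of $i$. Node $i$ has speed $s_i$; the minimum speed is $1$; $s=s_1+\dots+s_n$. For each edge there is a parameter $\alpha_{i,j}=\alpha_{j,i}>0$ with $\sum_{j\in N(i)}\alpha_{i,j}\le 1$. $S=\mathrm{diag}(s_1,\dots,s_n)$, $L$ is the Laplacian with weights $\alpha$ ($L_{i,j}=-\alpha_{i,j}$ for $j\in N(i)$, $L_{i,i}=\sum_{j\in N(i)}\alpha_{i,j}$, other entries $0$), and $M=I-LS^{-1}$. $\lambda$ is the second largest eigenvalue of $M$ in magnitude. A total load $m$ is initially distributed over the nodes, $x(0)\ge 0$ entrywise. Continuous SOS: $y_{i,j}(0)=\alpha_{i,j}(x_i(0)/s_i-x_j(0)/s_j)$; for $t\ge1$, $y_{i,j}(t)=(\beta-1)y_{i,j}(t-1)+\beta\alpha_{i,j}(x_i(t)/s_i-x_j(t)/s_j)$ for $j\in N(i)$; and $x_i(t+1)=x_i(t)-\sum_{j\in N(i)}y_{i,j}(t)$, where $y_{i,j}(t)=-y_{j,i}(t)$ is the load sent from $i$ to $j$ in round $t$. The balanced load vector is $\bar x$ with $\bar x_i=m s_i/s$, and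 $\Delta(t)=\|x(t)-\bar x\|_\infty$. The transient load $\breve{x}_i(t)$ is the load of node $i$ in round $t$ after all outgoing flows have been sent but before any incoming flow is received: $\breve{x}_i(t)=x_i(t)-\sum_{j\in N(i):\,y_{i,j}(t)>0}y_{i,j}(t)$. The constant in $O(\cdot)$ is absolute. *)

(* Defs.v *)
From HB Require Import structures.
From mathcomp Require Import all_boot all_order all_algebra.
From mathcomp Require Import complex reals.
Set Implicit Arguments.
Unset Strict Implicit.
Unset Printing Implicit Defensive.
Import Order.TTheory GRing.Theory Num.Theory.
Local Open Scope ring_scope.

(** The eigenvalues of a real matrix are taken in [R[i]], and counted with
    algebraic multiplicity. *)
Definition eigenvalues (R : realType) (n : nat) (A : 'M[R]_n) : seq R[i] :=
  sval (closed_field_poly_normal (char_poly (map_mx (real_complex R) A))).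

(** The modulus of the second entry when the eigenvalues are listed by
    decreasing modulus; repeated eigenvalues are listed repeatedly, so for the
    diffusion matrix of a disconnected graph this is [1]. *)
Definition second_eigenvalue (R : realType) (n : nat) (A : 'M[R]_n) : R :=
  (sort >=%R [seq ComplexField.Normc.normc z | z <- eigenvalues A])`_1.

(** [e] is the adjacency relation of a simple graph on ['I_n]; the values of
    the weights [alpha] outside the edges are irrelevant. *)
Record network (R : realType) (n : nat)
    (e : rel 'I_n) (alpha : 'I_n -> 'I_n -> R) (s : 'I_n -> R) : Prop := {
  edge_sym : symmetric e;
  edge_irr : irreflexive e;
  alpha_sym : forall i j, e i j -> alpha i j = alpha j i;
  alpha_gt0 : forall i j, e i j -> 0 < alpha i j;
  alpha_sum : forall i, \sum_(j | e i j) alpha i j <= 1;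
  speed_ge1 : forall i, 1 <= s i;
  speed_min : exists i, s i = 1
}.

Definition laplacian (R : realType) (n : nat)
    (e : rel 'I_n) (alpha : 'I_n -> 'I_n -> R) : 'M[R]_n :=
  \matrix_(i, j) if i == j then \sum_(k | e i k) alpha i k
                 else if e i j then - alpha i j else 0.

Definition speed_mx (R : realType) (n : nat) (s : 'I_n -> R) : 'M[R]_n :=
  diag_mx (\row_i s i).

Definition diffusion_mx (R : realType) (n : nat) (e : rel 'I_n)
    (alpha : 'I_n -> 'I_n -> R) (s : 'I_n -> R) : 'M[R]_n :=
  1%:M - laplacian e alpha *m invmx (speed_mx s).

Definition beta_opt (R : realType) (lambda : R) : R :=
  2 / (1 + Num.sqrt (1 - lambda ^+ 2)).

(** [x t i] is the load of node [i] at the beginning of round [t], and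
    [y t i j] the signed load sent from [i] to [j] during round [t]. Antisymmetry
    of [y t] along the edges follows from the symmetry of [alpha]. *)
Record continuous_SOS (R : realType) (n : nat) (e : rel 'I_n)
    (alpha : 'I_n -> 'I_n -> R) (s : 'I_n -> R) (beta : R)
    (x : nat -> 'I_n -> R) (y : nat -> 'I_n -> 'I_n -> R) : Prop := {
  SOS_flow0 : forall i j, e i j ->
    y 0%N i j = alpha i j * (x 0%N i / s i - x 0%N j / s j);
  SOS_flowS : forall t i j, e i j ->
    y t.+1 i j = (beta - 1) * y t i j
                 + beta * alpha i j * (x t.+1 i / s i - x t.+1 j / s j);
  SOS_load : forall t i, x t.+1 i = x t i - \sum_(j | e i j) y t i j
}.

Definition balanced (R : realType) (n : nat) (s : 'I_n -> R) (m : R)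
    (i : 'I_n) : R :=
  m * s i / \sum_k s k.

Definition deviation (R : realType) (n : nat) (s : 'I_n -> R) (m : R)
    (z : 'I_n -> R) : R :=
  \big[Num.max/0]_i `|z i - balanced s m i|.

Definition transient (R : realType) (n : nat) (e : rel 'I_n)
    (z : 'I_n -> R) (w : 'I_n -> 'I_n -> R) (i : 'I_n) : R :=
  z i - \sum_(j | e i j && (0 < w i j)) w i j.

(* Main.v *)
Require Import Defs.
From HB Require Import structures.
From mathcomp Require Import all_boot all_order all_algebra.
From mathcomp Require Import complex reals sesquilinear spectral.
From mathcomp Require Import ring lra.
(**
  In terms of the potentials [u = S^-1 (x - xbar)] the process reads
  [u(t+1) = u(t) - S^-1 L w(t)], where [w] is driven by [u] alone and
  [y_ij(t) = alpha_ij (w_i(t) - w_j(t))]. In an orthogonal eigenbasis for the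
  [S]-weighted inner product, without the stationary direction, the coordinates
  [c_k] of [u] and [h_k] of [w] evolve independently, with eigenvalue [d_k],
  [|d_k| <= lambda]. For [beta = beta_opt] one has
  [c_k(t) = r^t (T_t(kappa) + a kappa U_{t-1}(kappa)) c_k(0)] with
  [r = sqrt (beta - 1)], [|kappa| <= 1], [a = sqrt (1 - lambda^2) <= 2 (1 - r)], so [|c_k(t)| <= 3 |c_k(0)|].

  - Outflow: by Cauchy-Schwarz its square is at most twice the energy
    [w^T L w = sum_k (1 - d_k) h_k^2], and [(1 - d_k) h_k = c_k(t) - c_k(t+1)]
    bounds this energy by [O(|c(0)|^2 / (1 - lambda))].
  - Load: [x_i - xbar_i] is the weighted product of [u] with the centred
    indicator of [i]. The Poincare inequality bounds the norm of the latter by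
    [1 / sqrt (1 - lambda)], which avoids a factor [sqrt s_i].

  Finally [|c(0)|^2 = sum_i s_i u_i(0)^2 <= n Delta(0)^2] because [s_i >= 1].
*)

Set Implicit Arguments.
Unset Strict Implicit.
Unset Printing Implicit Defensive.
Import Order.TTheory GRing.Theory Num.Theory.
Local Open Scope ring_scope.

(** * Scalar modes of the second order scheme *)

Section Scalar.
Variable R : realType.

(** With [r ^+ t] added, the left side starts at 1 and drops by [(t + 1) * r ^+ t * (1 - r) ^+ 2]
    from [t] to [t.+1]. The bound absorbs the linear growth of the second Chebyshev value. *)
Lemma natr_exp_le1 (r : R) (t : nat) :
  0 <= r <= 1 -> t%:R * r ^+ t * (1 - r) <= 1.
Proof.
move=> /andP[r0 r1].
suff: t%:R * r ^+ t * (1 - r) + r ^+ t <= 1.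
  by apply: le_trans; rewrite lerDl exprn_ge0.
elim: t => [|t IHt]; first by rewrite !mul0r add0r.
apply: le_trans IHt; rewrite exprS -natr1.
have rt : 0 <= r ^+ t by apply: exprn_ge0.
have : 0 <= (t%:R + 1) * r ^+ t * (1 - r) ^+ 2.
  by rewrite mulr_ge0 ?sqr_ge0// mulr_ge0// addr_ge0// ler0n.
lra.
Qed.

(* The pair [(T_t(k), U_{t-1}(k))] of Chebyshev values. *)
Fixpoint chebyshev (k : R) (t : nat) : R * R :=
  if t is t'.+1 then
    let: (T, U) := chebyshev k t' in (k * T - (1 - k ^+ 2) * U, k * U + T)
  else (1, 0).

(** Read [(T, U)] as [T + U * sqrt (k ^+ 2 - 1)]: each step multiplies by [k + sqrt (k ^+ 2 - 1)],
    an element of norm 1. *)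
Lemma chebyshev_pell (k : R) (t : nat) :
  (chebyshev k t).1 ^+ 2 + (1 - k ^+ 2) * (chebyshev k t).2 ^+ 2 = 1.
Proof.
elim: t => [|t] /=; first by ring.
by case: (chebyshev k t) => T U /= TU; rewrite -[RHS]TU; ring.
Qed.

Lemma chebyshev_le1 (k : R) (t : nat) : `|k| <= 1 -> `|(chebyshev k t).1| <= 1.
Proof.
move=> k1; have k2 : 0 <= 1 - k ^+ 2.
  by rewrite subr_ge0 -real_normK ?num_real// expr_le1.
rewrite -(@expr_le1 _ 2)// real_normK ?num_real// -(chebyshev_pell k t) lerDl.
by rewrite mulr_ge0 ?sqr_ge0.
Qed.

Lemma chebyshev_le_nat (k : R) (t : nat) :
  `|k| <= 1 -> `|(chebyshev k t).2| <= t%:R.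
Proof.
move=> k1; elim: t => [|t] /=; first by rewrite normr0.
have := chebyshev_le1 t k1.
case: (chebyshev k t) => T U /= T1 IHt.
rewrite (le_trans (ler_normD _ _))// -natr1 lerD// normrM.
by rewrite (le_trans _ IHt)// ler_piMl.
Qed.

(* [r] is the modulus of the roots of the characteristic polynomial
   [z^2 - 2 r k z + r^2]. *)
Lemma SOS_mode_eq (r k a : R) (c : nat -> R) (t : nat) :
  a * (1 + r ^+ 2) = 1 - r ^+ 2 ->
  c 1%N = (1 + a) * r * k * c 0%N ->
  (forall t, c t.+2 = 2 * r * k * c t.+1 - r ^+ 2 * c t) ->
  c t = r ^+ t * ((chebyshev k t).1 + a * k * (chebyshev k t).2) * c 0%N.
Proof.
move=> ar c1 cS.
(* The recurrence has order two, so the induction carries two consecutive values. *)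
suff: c t = r ^+ t * ((chebyshev k t).1 + a * k * (chebyshev k t).2) * c 0%N /\
  c t.+1 = r ^+ t.+1 *
    ((chebyshev k t.+1).1 + a * k * (chebyshev k t.+1).2) * c 0%N by case.
elim: t => [|t [IH0 IH1]]; first by rewrite /= c1; split; ring.
split=> //; rewrite cS IH0 IH1 /= !exprS.
by case: (chebyshev k t) => T U /=; ring.
Qed.

(** With [b = beta_opt lam], eliminating [h] gives [c t.+2 = b * mu * c t.+1 - (b - 1) * c t], and
    [|mu| <= lam] keeps both characteristic roots at modulus [sqrt (b - 1)]. In the factor 3, the
    first Chebyshev value accounts for 1 and the term with [a] for 2. *)
Lemma SOS_mode_bound (lam mu : R) (c h : nat -> R) (t : nat) :
  lam < 1 -> `|mu| <= lam ->
  h 0%N = c 0%N ->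
  (forall t, h t.+1 = (beta_opt lam - 1) * h t + beta_opt lam * c t.+1) ->
  (forall t, c t.+1 = c t - (1 - mu) * h t) ->
  `|c t| <= 3 * `|c 0%N|.
Proof.
move=> lam1 mulam h0 hS cS.
have lam0 : 0 <= lam by apply: le_trans mulam.
set a := Num.sqrt (1 - lam ^+ 2); have a0 : 0 <= a by exact: sqrtr_ge0.
have a2 : a ^+ 2 = 1 - lam ^+ 2.
  by rewrite sqr_sqrtr// subr_ge0 expr_le1// ltW.
have a1n0 : 1 + a != 0 by rewrite gt_eqF// ltr_wpDr.
have beq : beta_opt lam = 2 / (1 + a) by [].
(* Its square is [beta_opt lam - 1], because [lam ^+ 2 = (1 - a) * (1 + a)]. *)
pose r := lam / (1 + a).
have r0 : 0 <= r by rewrite divr_ge0// addr_ge0.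
have r1 : r <= 1 by rewrite ler_pdivrMr ?ltr_wpDr// mul1r ler_wpDr// ltW.
have r2 : beta_opt lam = 1 + r ^+ 2.
  rewrite beq /r expr_div_n (_ : lam ^+ 2 = 1 - a ^+ 2); last by rewrite a2; ring.
  by field.
have [k k1 mueq] : exists2 k, `|k| <= 1 & mu = lam * k.
  have [l0|ln0] := eqVneq lam 0.
    exists 0; first by rewrite normr0.
    by move: mulam; rewrite l0 normr_le0 mul0r => /eqP.
  exists (mu / lam); last by rewrite mulrC divfK.
  by rewrite normf_div (ger0_norm lam0) ler_pdivrMr ?mul1r// lt_neqAle eq_sym ln0.
have bm : beta_opt lam * mu = 2 * r * k by rewrite beq /r mueq; field.
have ar : a * (1 + r ^+ 2) = 1 - r ^+ 2.
  have : (1 + a) * (1 + r ^+ 2) = 2 by rewrite -r2 beq; field.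
  lra.
have -> : c t = r ^+ t * ((chebyshev k t).1 + a * k * (chebyshev k t).2) * c 0%N.
  apply: SOS_mode_eq => //.
    rewrite cS h0 mueq /r; field.
    exact: a1n0.
  move=> {}t; rewrite -bm (cS t.+1) hS.
  have -> : r ^+ 2 = beta_opt lam - 1 by rewrite r2; ring.
  have ht : (1 - mu) * h t = c t - c t.+1 by rewrite cS; ring.
  transitivity (c t.+1 - (beta_opt lam - 1) * ((1 - mu) * h t)
    - (1 - mu) * beta_opt lam * c t.+1); first by ring.
  by rewrite ht; ring.
rewrite normrM ler_wpM2r// normrM ger0_norm ?exprn_ge0//.
apply: (@le_trans _ _ (r ^+ t * (1 + a * t%:R))).
  rewrite ler_wpM2l ?exprn_ge0// (le_trans (ler_normD _ _))//.
  rewrite lerD ?chebyshev_le1// !normrM (ger0_norm a0) -mulrA ler_wpM2l//.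
  by rewrite (le_trans _ (chebyshev_le_nat t k1))// ler_piMl.
(* [a <= a * (1 + r ^+ 2) = (1 - r) * (1 + r)], and [r <= 1]. *)
have a_le : a <= 2 * (1 - r) by have := sqr_ge0 r; nra.
have rt1 : r ^+ t <= 1 by rewrite exprn_ile1.
have tr : t%:R * r ^+ t * (1 - r) <= 1 by rewrite natr_exp_le1 ?r0.
have trt : a * (t%:R * r ^+ t) <= 2 * (1 - r) * (t%:R * r ^+ t).
  by rewrite ler_wpM2r// mulr_ge0// exprn_ge0.
lra.
Qed.
End Scalar.

(** * Spectrum of the diffusion matrix *)

Section Spectrum.
Variable R : realType.

(** Past the head, a decreasing list never exceeds its second entry. For lists shorter than two the
    count is small whatever the default value. *)
Lemma count_gt_nth1_sort (s : seq R) :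
  (count (fun z => ((sort >=%R s)`_1 < z)%R) s <= 1)%N.
Proof.
rewrite -(permP (permEl (perm_sort >=%R s))).
have := sort_sorted (@ge_total _ R) s.
case: (sort _ s) => [|a [|b t]]//=; first by case: (_ < _).
move=> /andP[_ bt]; rewrite ltxx add0n.
have /all_filterP bt' := order_path_min (@ge_trans _ R) bt.
suff -> : count (fun z => b < z) t = 0%N by rewrite addn0; case: (_ < _).
apply/eqP; rewrite -leqn0 leqNgt -has_count; apply/hasPn => z zt.
by rewrite -leNgt; move: zt; rewrite -bt' mem_filter => /andP[].
Qed.

Lemma char_poly_conj (F : fieldType) (n : nat) (P A : 'M[F]_n) :
  P \in unitmx -> char_poly (invmx P *m A *m P) = char_poly A.
Proof.
move=> Pu; pose Pp := map_mx (@polyC F) P; pose Pi := map_mx (@polyC F) (invmx P).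
have PiP : Pi *m Pp = 1%:M by rewrite -map_mxM mulVmx// map_mx1.
rewrite /char_poly /char_poly_mx !map_mxM -/Pp -/Pi.
have -> : 'X%:M - Pi *m map_mx polyC A *m Pp = Pi *m ('X%:M - map_mx polyC A) *m Pp.
  rewrite mulmxBr mulmxBl; congr (_ - _).
  by rewrite mul_mx_scalar -scalemxAl PiP scalemx1.
by rewrite !det_mulmx mulrAC -det_mulmx PiP det1 mul1r.
Qed.

(** Both lists give a factorization of the characteristic polynomial into monic linear factors,
    which is unique up to order. *)
Lemma eigenvalues_diag (n : nat) (A : 'M[R]_n) (P : 'M[R[i]]_n) (d : 'I_n -> R) :
  P \in unitmx ->
  map_mx (real_complex R) A = invmx P *m diag_mx (\row_k (d k)%:C%C) *m P ->
  perm_eq (eigenvalues A) [seq (d k)%:C%C | k <- enum 'I_n].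
Proof.
move=> Pu AE; apply: prod_XsubC_eq; rewrite /eigenvalues.
case: closed_field_poly_normal => r /= rE.
move: rE; rewrite (monicP (char_poly_monic _)) scale1r => <-.
rewrite AE char_poly_conj// char_poly_trig ?diag_mx_is_trig// big_map enumT.
by apply: eq_bigr => k _; rewrite !mxE eqxx mulr1n.
Qed.

Lemma normc_real (x : R) : ComplexField.Normc.normc (x%:C%C : R[i]) = `|x|.
Proof. by rewrite /= expr0n addr0 sqrtr_sqr. Qed.

(** Two distinct indices above the second modulus would contribute two entries to the count in
    [count_gt_nth1_sort], even if their eigenvalues coincide. *)
Lemma second_eigenvalue_diag (n : nat) (A : 'M[R]_n) (P : 'M[R[i]]_n)
    (d : 'I_n -> R) (k k' : 'I_n) :
  P \in unitmx ->
  map_mx (real_complex R) A = invmx P *m diag_mx (\row_k (d k)%:C%C) *m P ->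
  second_eigenvalue A < `|d k| -> k' != k -> `|d k'| <= second_eigenvalue A.
Proof.
move=> Pu AE dk kk'; rewrite leNgt; apply/negP => dk'.
rewrite -normc_real in dk; rewrite -normc_real in dk'.
have := count_gt_nth1_sort
  [seq ComplexField.Normc.normc z | z <- eigenvalues A].
rewrite -/(second_eigenvalue A) (permP (perm_map _ (eigenvalues_diag Pu AE))).
rewrite -map_comp count_map leqNgt => /negP; apply.
have -> : 2%N = #|[set k'; k]| by rewrite cards2 kk'.
rewrite -size_filter cardE.
apply: uniq_leq_size; first exact: enum_uniq.
move=> j; rewrite mem_enum !inE mem_filter mem_enum andbT.
by case/orP => /eqP ->.
Qed.
End Spectrum.

(** * Diagonalization in the speed-weighted inner product *)

Section Decomposition.
Variable R : realType.
Local Notation toC := (map_mx (real_complex R)).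
Local Open Scope sesquilinear_scope.

Lemma invmx_eq (F : fieldType) (n : nat) (A B : 'M[F]_n) :
  A *m B = 1%:M -> invmx A = B.
Proof.
by move=> AB; rewrite -[LHS]mulmx1 -AB mulKmx//; case: (mulmx1_unit AB).
Qed.

Lemma symmetric_diagonalization (n : nat) (A : 'M[R]_n) : A^T = A ->
  exists (U : 'M[R[i]]_n) (d : 'I_n -> R),
    U \is unitarymx /\ toC A = invmx U *m diag_mx (\row_k (d k)%:C%C) *m U.
Proof.
move=> Asym.
have Aherm : toC A \is hermsymmx.
  apply: realsym_hermsym.
    by apply/is_hermitianmxP; rewrite expr0 scale1r map_mx_id// map_trmx Asym.
  by apply/mxOverP => i j; rewrite mxE complex_real.
exists (spectralmx (toC A)), (fun k => complex.Re (spectral_diag (toC A) 0 k)).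
split; first exact: spectral_unitarymx.
rewrite [LHS](orthomx_spectralP (hermitian_normalmx Aherm)).
have dreal := mxOverP (hermitian_spectral_diag_real Aherm).
suff -> : (\row_k (complex.Re (spectral_diag (toC A) 0 k))%:C%C)%R =
  spectral_diag (toC A) by [].
by apply/rowP => k; rewrite mxE (RRe_real (dreal 0 k)).
Qed.

(** With [H] and [K] the square roots of [S] and of its inverse, the diffusion matrix is similar to
    the symmetric [Q = 1 - K L K]. If the unitary [U] diagonalizes [Q], then [U H] gives coordinates
    that are orthonormal for the weight [S], and [U K] diagonalizes the diffusion matrix itself. *)
Lemma diffusion_diagonalization (n : nat) (s : 'I_n -> R) (L : 'M[R]_n) :
  (forall i, 0 < s i) -> L^T = L ->
  exists (V P : 'M[R[i]]_n) (d : 'I_n -> R),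
    [/\ V \in unitmx, V^t* *m V = toC (speed_mx s),
        V *m toC (invmx (speed_mx s) *m L) =
          (1%:M - diag_mx (\row_k (d k)%:C%C)) *m V,
        P \in unitmx &
        toC (1%:M - L *m invmx (speed_mx s)) =
          invmx P *m diag_mx (\row_k (d k)%:C%C) *m P].
Proof.
move=> s0 Lsym.
pose H := diag_mx (\row_i Num.sqrt (s i)); pose K := diag_mx (\row_i (Num.sqrt (s i))^-1).
have HK : H *m K = 1%:M.
  rewrite mulmx_diag; apply/matrixP => i j; rewrite !mxE mulfV//.
  by rewrite gt_eqF// sqrtr_gt0.
have KH : K *m H = 1%:M by apply: mulmx1C.
have HH : H *m H = speed_mx s.
  rewrite mulmx_diag; congr diag_mx; apply/rowP => i.
  by rewrite !mxE -expr2 sqr_sqrtr// ltW.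
have SV : invmx (speed_mx s) = K *m K.
  by apply: invmx_eq; rewrite -HH mulmxA -(mulmxA H) HK mulmx1.
pose Q := 1%:M - K *m L *m K.
have Qsym : Q^T = Q.
  by rewrite /Q raddfB /= trmx1 !trmx_mul Lsym tr_diag_mx mulmxA.
have [U [d [Uu QE]]] := symmetric_diagonalization Qsym.
have Uunit := unitarymx_unit Uu.
set D := diag_mx _ in QE.
exists (U *m toC H), (U *m toC K), d; rewrite -/D SV.
have HKc : toC H *m toC K = 1%:M by rewrite -map_mxM HK map_mx1.
have KHc : toC K *m toC H = 1%:M by rewrite -map_mxM KH map_mx1.
have [Hu Ku] := mulmx1_unit HKc.
have UQ : U *m toC Q = D *m U by rewrite QE -!mulmxA mulKVmx.
split.
- by rewrite unitmx_mul Uunit.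
- have -> : (U *m toC H)^t* = toC H *m U^t*.
    rewrite trmx_mul map_mxM; congr (_ *m _).
    apply/matrixP => i j; rewrite !mxE eq_sym; case: eqP => [->|_].
      by rewrite !mulr1n; exact: conjc_real.
    by rewrite !mulr0n; exact: conjc_real.
  rewrite mulmxA -(mulmxA (toC H)) -[U^t*]invmx_unitary// mulVmx// mulmx1.
  by rewrite -map_mxM HH.
- have -> : (1%:M - D) *m (U *m toC H) = U *m toC ((1%:M - Q) *m H).
    have Q1 : toC (1%:M - Q) = 1%:M - toC Q by rewrite map_mxB map_mx1.
    by rewrite mulmxA mulmxBl mul1mx -UQ map_mxM Q1 mulmxA mulmxBr mulmx1.
  rewrite -mulmxA -map_mxM; congr (_ *m toC _).
  by rewrite subKr -!mulmxA KH mulmx1 !mulmxA HK mul1mx.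
- by rewrite unitmx_mul Uunit.
- have -> : invmx (U *m toC K) = toC H *m invmx U.
    apply: invmx_eq; rewrite mulmxA -(mulmxA U) KHc mulmx1 mulmxV//.
  have -> : 1%:M - L *m (K *m K) = H *m Q *m K.
    by rewrite /Q mulmxBr mulmx1 mulmxBl HK !mulmxA HK mul1mx.
  by rewrite !map_mxM QE !mulmxA.
Qed.
End Decomposition.

(** * Real coordinates transverse to the stationary direction *)

Section Frame.
Variable R : realType.
Local Notation toC := (map_mx (real_complex R)).
Local Open Scope sesquilinear_scope.

Lemma Re_sum (I : finType) (F : I -> R[i]) :
  complex.Re (\sum_i F i) = \sum_i complex.Re (F i).
Proof. by apply: (big_morph (@complex.Re R)) => // -[a b] [c d]. Qed.

Lemma Im_sum (I : finType) (F : I -> R[i]) :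
  complex.Im (\sum_i F i) = \sum_i complex.Im (F i).
Proof. by apply: (big_morph (@complex.Im R)) => // -[a b] [c d]. Qed.

Lemma Re_mul_real (z : R[i]) (a : R) : complex.Re (z * a%:C%C) = complex.Re z * a.
Proof. by case: z => x y /=; rewrite mulr0 subr0. Qed.

Lemma Im_mul_real (z : R[i]) (a : R) : complex.Im (z * a%:C%C) = complex.Im z * a.
Proof. by case: z => x y /=; rewrite mulr0 add0r. Qed.

Lemma Re_conj_mul (z w : R[i]) : complex.Re (Num.conj z * w) =
  complex.Re z * complex.Re w + complex.Im z * complex.Im w.
Proof. by case: z w => x y [x' y'] /=; rewrite mulNr opprK. Qed.

Lemma second_eigenvalue_ge0 (n : nat) (A : 'M[R]_n) : 0 <= second_eigenvalue A.
Proof.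
rewrite /second_eigenvalue; set t := sort _ _.
have [t1|/(nth_default 0) -> //] := ltnP 1 (size t).
have := mem_nth 0 t1; rewrite mem_sort => /mapP[z _ ->].
by rewrite -lecR; exact: (normr_ge0 z).
Qed.

(* The rows of [P] are the real and imaginary parts of a complex eigenbasis; the
   row of the eigenvalue [1] is replaced by [0], which is why [v] must have zero
   weighted mean in the last clause. *)
Lemma diffusion_frame (n : nat) (s : 'I_n -> R) (L : 'M[R]_n) (lam : R) :
  (0 < n)%N -> (forall i, 0 < s i) -> L^T = L -> L *m const_mx 1 = 0 :> 'cV_n ->
  lam = second_eigenvalue (1%:M - L *m invmx (speed_mx s)) -> lam < 1 ->
  exists (P : 'M[R]_(n + n, n)) (d : 'I_(n + n) -> R),
    [/\ forall k, `|d k| <= lam,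
        forall (v : 'cV_n) k, (P *m (invmx (speed_mx s) *m L *m v)) k 0 =
                              (1 - d k) * (P *m v) k 0 &
        forall u v : 'cV_n, \sum_i s i * v i 0 = 0 ->
          \sum_k (P *m u) k 0 * (P *m v) k 0 = \sum_i s i * u i 0 * v i 0].
Proof.
move=> n0 s0 Lsym L1 lamE lam1.
have [V [P [d [Vu VV VL Pu ME]]]] := diffusion_diagonalization s0 Lsym.
pose one : 'cV[R]_n := const_mx 1.
have VLk (v : 'cV[R]_n) k :
    (V *m toC (invmx (speed_mx s) *m L *m v)) k 0 = (1 - (d k)%:C%C) * (V *m toC v) k 0.
  rewrite map_mxM mulmxA VL -mulmxA mulmxBl mul1mx mxE mul_diag_mx.
  by rewrite !mxE mulrBl mul1r.
have V1 k : (1 - (d k)%:C%C) * (V *m toC one) k 0 = 0.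
  by rewrite -VLk -mulmxA L1 mulmx0 map_mx0 mulmx0 mxE.
(* [V] is invertible, so the constant vector has a nonzero coordinate; by [V1] its eigenvalue is
   1. *)
have [k0 Vk0] : exists k0, (V *m toC one) k0 0 != 0.
  apply/existsP; apply: contraT; rewrite negb_exists => /forallP Vz.
  suff /matrixP/(_ (Ordinal n0) 0) : toC one = 0.
    by rewrite !mxE => /eqP; rewrite oner_eq0.
  rewrite -(mulKmx Vu (toC one)); suff -> : V *m toC one = 0 by rewrite mulmx0.
  by apply/matrixP => k j; rewrite ord1 [RHS]mxE; apply/eqP; have := Vz k; rewrite negbK.
have dk0 : d k0 = 1.
  have /eqP := V1 k0; rewrite mulf_eq0 (negbTE Vk0) orbF subr_eq0 => /eqP.
  by move=> /complexI.
(* The eigenvalue 1 at [k0] already exceeds [lam], so no other index can. *)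
have dk k : k != k0 -> `|d k| <= lam.
  move=> kk0; rewrite lamE; apply: (second_eigenvalue_diag Pu ME (k := k0)) => //.
  by rewrite -lamE dk0 normr1.
have VVdot (u v : 'cV[R]_n) :
    \sum_k Num.conj ((V *m toC u) k 0) * (V *m toC v) k 0 =
    (\sum_i s i * u i 0 * v i 0)%:C%C.
  transitivity (((V *m toC u)^t* *m (V *m toC v)) 0 0).
    by rewrite mxE; apply: eq_bigr => k _; rewrite !mxE.
  rewrite trmx_mul map_mxM !mulmxA -(mulmxA _ _ V) VV.
  have -> : (toC u)^t* = toC u^T.
    by apply/matrixP => i j; rewrite !mxE; exact: conjc_real.
  rewrite -!map_mxM [LHS]mxE; congr (_%:C%C).
  rewrite -mulmxA mul_diag_mx mxE; apply: eq_bigr => i _.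
  by rewrite !mxE mulrA (mulrC (u i 0)).
(* All other eigenvalues differ from 1, so by [V1] the constant vector lies along [k0] alone; zero
   weighted mean is orthogonality to it. *)
have Vperp (v : 'cV[R]_n) : \sum_i s i * v i 0 = 0 -> (V *m toC v) k0 0 = 0.
  move=> sv; have := VVdot one v.
  rewrite (bigD1 k0)//= [X in _ + X]big1 ?addr0; last first.
    move=> k kk0; have /eqP := V1 k; rewrite mulf_eq0 subr_eq0 => /orP[/eqP|].
      move=> /(@complexI _ 1) d1; have := dk k kk0.
      by rewrite -d1 normr1 leNgt lam1.
    by move=> /eqP ->; rewrite conjC0 mul0r.
  rewrite (eq_bigr (fun i => s i * v i 0)) => [|i _]; last by rewrite mxE mulr1.
  by rewrite sv => /eqP; rewrite mulf_eq0 conjC_eq0 (negbTE Vk0) => /eqP.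
pose W : 'M[R[i]]_n := \matrix_(k, i) if k == k0 then 0 else V k i.
have WE (v : 'cV[R]_n) k :
    (W *m toC v) k 0 = if k == k0 then 0 else (V *m toC v) k 0.
  rewrite mxE; case: eqP => kk0; last first.
    by rewrite mxE; apply: eq_bigr => i _; rewrite !mxE; move/eqP/negbTE: kk0 => ->.
  by rewrite big1// => i _; rewrite mxE kk0 eqxx mul0r.
have ReW (v : 'cV[R]_n) k :
    (map_mx (@complex.Re R) W *m v) k 0 = complex.Re ((W *m toC v) k 0).
  by rewrite !mxE Re_sum; apply: eq_bigr => i _; rewrite !mxE Re_mul_real.
have ImW (v : 'cV[R]_n) k :
    (map_mx (@complex.Im R) W *m v) k 0 = complex.Im ((W *m toC v) k 0).
  by rewrite !mxE Im_sum; apply: eq_bigr => i _; rewrite !mxE Im_mul_real.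
(* On the erased row any eigenvalue satisfies the relation; 0 also respects the bound by [lam],
   which is nonnegative. *)
pose d0 k := if k == k0 then 0 else d k.
have WL (v : 'cV[R]_n) k : (W *m toC (invmx (speed_mx s) *m L *m v)) k 0 =
    (W *m toC v) k 0 * (1 - d0 k)%:C%C.
  rewrite !WE /d0; case: eqP => _; first by rewrite mul0r.
  by rewrite VLk mulrC rmorphB rmorph1.
exists (col_mx (map_mx (@complex.Re R) W) (map_mx (@complex.Im R) W)).
exists (fun k => match split k with inl j => d0 j | inr j => d0 j end).
split.
- move=> k; have d0k j : `|d0 j| <= lam.
    rewrite /d0; case: eqP => [_|/eqP/dk//].
    by rewrite normr0 lamE second_eigenvalue_ge0.
  by case: (split k).
- move=> v k; rewrite !mul_col_mx; case: (splitP k) => j kj.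
    have -> : k = lshift n j by apply: val_inj.
    by rewrite !col_mxEu !ReW WL Re_mul_real mulrC.
  have -> : k = rshift n j by apply: val_inj.
  by rewrite !col_mxEd !ImW WL Im_mul_real mulrC.
- move=> u v sv; rewrite big_split_ord /= -big_split /=.
  rewrite -[RHS]/(complex.Re (_%:C%C)) -VVdot Re_sum; apply: eq_bigr => k _.
  rewrite !mul_col_mx !col_mxEu !col_mxEd !ReW !ImW -Re_conj_mul !WE.
  by case: eqP => // ->; rewrite (Vperp v sv) !mulr0.
Qed.
End Frame.

(** * Laplacian, flows and loads *)

Section Network.
Variable R : realType.

(** Lagrange's identity: twice the gap is a double sum of weighted squares. *)
Lemma weighted_CauchySchwarz (I : finType) (p a b : I -> R) :
  (forall i, 0 <= p i) ->
  (\sum_i p i * (a i * b i)) ^+ 2 <=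
  (\sum_i p i * a i ^+ 2) * (\sum_i p i * b i ^+ 2).
Proof.
move=> p0; rewrite -subr_ge0 -(pmulr_rge0 _ (ltr0n R 2)).
suff -> : 2 * ((\sum_i p i * a i ^+ 2) * (\sum_i p i * b i ^+ 2) -
    (\sum_i p i * (a i * b i)) ^+ 2) =
    \sum_i \sum_j p i * p j * (a i * b j - a j * b i) ^+ 2.
  by apply: sumr_ge0 => i _; apply: sumr_ge0 => j _; rewrite mulr_ge0 ?sqr_ge0 ?mulr_ge0.
transitivity ((\sum_i p i * a i ^+ 2) * (\sum_i p i * b i ^+ 2) +
   (\sum_i p i * b i ^+ 2) * (\sum_i p i * a i ^+ 2) -
   2 * ((\sum_i p i * (a i * b i)) * (\sum_i p i * (a i * b i)))).
  by ring.
rewrite !big_distrlr /= -big_split /= mulr_sumr -sumrB; apply: eq_bigr => i _.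
by rewrite -big_split /= mulr_sumr -sumrB; apply: eq_bigr => j _; ring.
Qed.

Variables (n : nat) (e : rel 'I_n) (alpha : 'I_n -> 'I_n -> R) (s : 'I_n -> R).
Hypothesis G : network e alpha s.
Let L := laplacian e alpha.

Lemma speed_gt0 (i : 'I_n) : 0 < s i.
Proof. exact: lt_le_trans ltr01 (speed_ge1 G i). Qed.

Lemma laplacian_mulE (v : 'cV[R]_n) (i : 'I_n) :
  (L *m v) i 0 = \sum_(j | e i j) alpha i j * (v i 0 - v j 0).
Proof.
rewrite mxE (bigD1 i)//= mxE eqxx mulr_suml big_mkcond [in RHS]big_mkcond /=.
rewrite [X in _ + X]big_mkcond -big_split /=; apply: eq_bigr => j _.
rewrite mxE eq_sym; have [->|ji] /= := eqVneq i j; first by rewrite (edge_irr G) addr0.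
by case: ifP => _; [rewrite mulNr mulrBr | rewrite mul0r addr0].
Qed.

Lemma laplacian_sym : L^T = L.
Proof.
apply/matrixP => i j; rewrite !mxE eq_sym; case: eqP => [->//|_].
by rewrite (edge_sym G j i); case: ifP => // eij; rewrite (alpha_sym G eij).
Qed.

Lemma laplacian_const : L *m const_mx 1 = 0 :> 'cV_n.
Proof.
apply/matrixP => i j; rewrite ord1 laplacian_mulE [RHS]mxE big1// => k _.
by rewrite !mxE subrr mulr0.
Qed.

(** Averaging the form with its copy under exchange of edge endpoints produces the squares. The
    factor 2 appears because the right side runs over ordered pairs. *)
Lemma laplacian_energy (v : 'cV[R]_n) :
  2 * (\sum_i v i 0 * (L *m v) i 0) =
  \sum_i \sum_(j | e i j) alpha i j * (v i 0 - v j 0) ^+ 2.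
Proof.
have swap : \sum_i v i 0 * (L *m v) i 0 =
    \sum_i \sum_(j | e i j) alpha i j * (v j 0 * (v j 0 - v i 0)).
  under eq_bigr => i _ do rewrite laplacian_mulE mulr_sumr.
  rewrite (exchange_big_dep predT)//=; apply: eq_bigr => j _.
  rewrite (eq_bigl (e j)) => [|i]; last by rewrite (edge_sym G i).
  by apply: eq_bigr => i eji; rewrite (alpha_sym G eji); ring.
rewrite mulr_natl mulr2n [in X in _ + X]swap -big_split; apply: eq_bigr => i _ /=.
rewrite laplacian_mulE mulr_sumr -big_split; apply: eq_bigr => j _ /=; ring.
Qed.

(** Cauchy-Schwarz with the edge weights at [i], of total at most 1, leaves one row of the double
    sum in [laplacian_energy]. *)
Lemma outflow_sqr_le (v : 'cV[R]_n) (q : pred 'I_n) (i : 'I_n) :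
  (\sum_(j | e i j && q j) alpha i j * (v i 0 - v j 0)) ^+ 2 <=
  2 * (\sum_k v k 0 * (L *m v) k 0).
Proof.
have row_ge0 k : 0 <= \sum_(j | e k j) alpha k j * (v k 0 - v j 0) ^+ 2.
  by apply: sumr_ge0 => j ekj; rewrite mulr_ge0 ?sqr_ge0// ltW// (alpha_gt0 G ekj).
apply: (@le_trans _ _ (\sum_(j | e i j) alpha i j * (v i 0 - v j 0) ^+ 2)); last first.
  by rewrite laplacian_energy [leRHS](bigD1 i)//= lerDl sumr_ge0.
(* Off the edges [alpha] is arbitrary and may be negative, hence the extension by 0. *)
pose p j := if e i j && q j then alpha i j else 0.
have p0 j : 0 <= p j.
  by rewrite /p; case: ifP => // /andP[eij _]; rewrite ltW// (alpha_gt0 G eij).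
have p_le j : p j <= if e i j then alpha i j else 0.
  rewrite /p; case: ifP => [/andP[-> _]//|_].
  by case: ifP => // eij; rewrite ltW// (alpha_gt0 G eij).
have -> : \sum_(j | e i j && q j) alpha i j * (v i 0 - v j 0) =
    \sum_j p j * (1 * (v i 0 - v j 0)).
  by rewrite big_mkcond; apply: eq_bigr => j _; rewrite /p mul1r; case: ifP; rewrite ?mul0r.
apply: le_trans (weighted_CauchySchwarz _ _ p0) _.
rewrite -[leRHS]mul1r; apply: ler_pM.
- by apply: sumr_ge0 => j _; rewrite expr1n mulr1.
- by apply: sumr_ge0 => j _; rewrite mulr_ge0 ?sqr_ge0.
- apply: le_trans (alpha_sum G i); rewrite [leRHS]big_mkcond.
  by apply: ler_sum => j _; rewrite expr1n mulr1.
rewrite [leRHS]big_mkcond; apply: ler_sum => j _; have := p_le j.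
by case: ifP => _ pj; [|rewrite -(mul0r ((v i 0 - v j 0) ^+ 2))];
   apply: ler_wpM2r pj; apply: sqr_ge0.
Qed.

(** The flow recursion is linear with the same [beta] on every edge, so the flow remains [alpha]
    times the difference of a node potential, which this recursion computes. *)
Fixpoint SOS_potential (beta : R) (u : nat -> 'cV[R]_n) (t : nat) : 'cV[R]_n :=
  if t is t'.+1 then (beta - 1) *: SOS_potential beta u t' + beta *: u t else u 0%N.

Lemma laplacian_sum (v : 'cV[R]_n) : \sum_i (L *m v) i 0 = 0.
Proof.
transitivity (((const_mx 1 : 'cV_n)^T *m (L *m v)) 0 0).
  by rewrite [RHS]mxE; apply: eq_bigr => i _; rewrite 2![X in _ = X * _]mxE mul1r.
by rewrite mulmxA -{1}laplacian_sym -trmx_mul laplacian_const trmx0 mul0mx mxE.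
Qed.

Lemma invmx_speed_mulE (v : 'cV[R]_n) (i : 'I_n) :
  (invmx (speed_mx s) *m v) i 0 = v i 0 / s i.
Proof.
have -> : invmx (speed_mx s) = diag_mx (\row_i (s i)^-1).
  apply: invmx_eq; rewrite mulmx_diag; apply/matrixP => j k; rewrite !mxE mulfV//.
  by rewrite gt_eqF// speed_gt0.
by rewrite mul_diag_mx !mxE mulrC.
Qed.

Lemma speed_laplacian_sum (v : 'cV[R]_n) :
  \sum_i s i * (invmx (speed_mx s) *m L *m v) i 0 = 0.
Proof.
rewrite -[RHS](laplacian_sum v); apply: eq_bigr => i _.
by rewrite -mulmxA invmx_speed_mulE mulrC divfK// gt_eqF// speed_gt0.
Qed.

(** * Potential form of the process and conservation of load *)

Section Process.
Variables (m beta : R) (x : nat -> 'I_n -> R) (y : nat -> 'I_n -> 'I_n -> R).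
Hypothesis n_gt0 : (0 < n)%N.
Hypothesis x0_sum : \sum_i x 0%N i = m.
Hypothesis XY : continuous_SOS e alpha s beta x y.

Let u t : 'cV[R]_n := \col_i (x t i / s i - m / \sum_k s k).
Let w := SOS_potential beta u.

Lemma speed_sum_gt0 : 0 < \sum_k s k.
Proof.
rewrite (bigD1 (Ordinal n_gt0))//= ltr_wpDr ?speed_gt0//.
by apply: sumr_ge0 => i _; rewrite ltW// speed_gt0.
Qed.

Lemma speed_load (t : nat) (i : 'I_n) : s i * u t i 0 = x t i - balanced s m i.
Proof.
rewrite mxE mulrBr mulrC divfK ?gt_eqF ?speed_gt0// /balanced.
by rewrite mulrCA mulrA.
Qed.

Lemma SOS_flowE (t : nat) (i j : 'I_n) : e i j ->
  y t i j = alpha i j * (w t i 0 - w t j 0).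
Proof.
move=> eij; elim: t => [|t IHt].
  by rewrite (SOS_flow0 XY eij) !mxE; ring.
by rewrite (SOS_flowS XY _ eij) IHt !mxE; ring.
Qed.

Lemma SOS_loadE (t : nat) : u t.+1 = u t - invmx (speed_mx s) *m L *m w t.
Proof.
apply/matrixP => i j; rewrite ord1 [RHS]mxE [X in _ = _ + X]mxE -mulmxA invmx_speed_mulE.
rewrite laplacian_mulE !mxE (SOS_load XY).
by under eq_bigr => k ik do rewrite SOS_flowE//; ring.
Qed.

(** Conservation of the total load; it places [u t] where the frame preserves weighted inner
    products. *)
Lemma SOS_balance (t : nat) : \sum_i s i * u t i 0 = 0.
Proof.
elim: t => [|t IHt].
  under eq_bigr => i _ do rewrite speed_load.
  rewrite sumrB x0_sum /balanced -mulr_suml -mulr_sumr mulfK ?subrr//.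
  by rewrite gt_eqF// speed_sum_gt0.
rewrite SOS_loadE.
under eq_bigr => i _ do rewrite mxE mulrDr [X in _ + s i * X]mxE mulrN.
by rewrite sumrB IHt speed_laplacian_sum subr0.
Qed.

Lemma SOS_potential_balance (t : nat) : \sum_i s i * w t i 0 = 0.
Proof.
elim: t => [|t IHt]; first exact: SOS_balance.
rewrite (eq_bigr (fun i => (beta - 1) * (s i * w t i 0) + beta * (s i * u t.+1 i 0))).
  by rewrite big_split /= -!mulr_sumr IHt SOS_balance !mulr0 addr0.
by move=> i _; rewrite /w /= !mxE; ring.
Qed.

End Process.

(** * Energy and single-node loads in frame coordinates *)

Section FrameEstimates.
Variables (N : nat) (P : 'M[R]_(N, n)) (d : 'I_N -> R) (lam : R).
Hypothesis lam1 : lam < 1.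
Hypothesis d_le : forall k, `|d k| <= lam.
Hypothesis PL : forall (v : 'cV_n) k,
  (P *m (invmx (speed_mx s) *m L *m v)) k 0 = (1 - d k) * (P *m v) k 0.
Hypothesis Pdot : forall u v : 'cV_n, \sum_i s i * v i 0 = 0 ->
  \sum_k (P *m u) k 0 * (P *m v) k 0 = \sum_i s i * u i 0 * v i 0.

Lemma gap_le (k : 'I_N) : 1 - lam <= 1 - d k.
Proof. by rewrite lerD2l lerN2 (le_trans (ler_norm _)). Qed.

(** Parseval for [v] and its image under the inverse speeds times [L]; the weight [s i] cancels the
    inverse speed. *)
Lemma frame_energy (v : 'cV[R]_n) : \sum_i s i * v i 0 = 0 ->
  \sum_k (1 - d k) * (P *m v) k 0 ^+ 2 = \sum_i v i 0 * (L *m v) i 0.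
Proof.
move=> sv; transitivity (\sum_k
    (P *m (invmx (speed_mx s) *m L *m v)) k 0 * (P *m v) k 0).
  by apply: eq_bigr => k _; rewrite PL expr2 mulrA.
rewrite Pdot//; apply: eq_bigr => i _; rewrite -mulmxA invmx_speed_mulE.
by rewrite [s i * _]mulrC divfK ?gt_eqF ?speed_gt0// mulrC.
Qed.

(* Poincare inequality for the indicator of [i], centred to have zero
   [s]-weighted mean: its energy is the weighted degree of [i], at most [1]. *)
Lemma frame_coordinate_le (v : 'cV[R]_n) (i : 'I_n) : \sum_j s j * v j 0 = 0 ->
  (s i * v i 0) ^+ 2 * (1 - lam) <= \sum_k (P *m v) k 0 ^+ 2.
Proof.
move=> sv; have tot0 : 0 < \sum_k s k by apply: speed_sum_gt0; case: (n) i => [[]|].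
pose c := s i / \sum_k s k; pose z : 'cV[R]_n := \col_j ((j == i)%:R - c).
have sz : \sum_j s j * z j 0 = 0.
  under eq_bigr => j _ do rewrite mxE mulrBr.
  rewrite sumrB -mulr_suml mulrC divfK ?gt_eqF// (bigD1 i)//= eqxx mulr1.
  by rewrite big1 ?addr0 ?subrr// => j /negbTE ->; rewrite mulr0.
have zdot (r : 'I_n -> R) : \sum_j r j = 0 -> \sum_j z j 0 * r j = r i.
  move=> r0; under eq_bigr => j _ do rewrite mxE mulrBl.
  rewrite sumrB -mulr_sumr r0 mulr0 subr0 (bigD1 i)//= eqxx mul1r.
  by rewrite big1 ?addr0// => j /negbTE ->; rewrite mul0r.
have vi : s i * v i 0 = \sum_k (P *m v) k 0 * (P *m z) k 0.
  rewrite Pdot// -(zdot (fun j => s j * v j 0))//.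
  by apply: eq_bigr => j _; rewrite mulrC.
(* [L *m z] sums to zero, so [zdot] reduces the energy to the entry at [i]. *)
have Ez : \sum_k (1 - d k) * (P *m z) k 0 ^+ 2 <= 1.
  rewrite frame_energy// zdot ?laplacian_sum// laplacian_mulE.
  apply: le_trans (alpha_sum G i); apply: ler_sum => j eij.
  have /negbTE ji : j != i by apply: contraTneq eij => ->; rewrite (edge_irr G).
  by rewrite !mxE eqxx ji sub0r opprK subrK mulr1.
have Pz : (1 - lam) * \sum_k (P *m z) k 0 ^+ 2 <= 1.
  apply: le_trans Ez; rewrite mulr_sumr; apply: ler_sum => k _.
  by rewrite ler_wpM2r ?sqr_ge0 ?gap_le.
have := @weighted_CauchySchwarz _ (fun=> 1) (fun k => (P *m v) k 0)
  (fun k => (P *m z) k 0) (fun=> ler01).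
under eq_bigr do rewrite mul1r.
under [X in _ <= X * _]eq_bigr do rewrite mul1r.
under [X in _ <= _ * X]eq_bigr do rewrite mul1r.
rewrite -vi => CS; have lam0 : 0 <= 1 - lam by rewrite subr_ge0 ltW.
apply: le_trans (ler_wpM2r lam0 CS) _.
by rewrite -mulrA ler_piMr ?sumr_ge0// 1?mulrC// => k _; rewrite sqr_ge0.
Qed.
End FrameEstimates.
End Network.

(** Reduces the load and outflow bounds to inequalities between squares, free of roots and
    quotients. *)
Lemma le_sqrt_quotient (R : rcfType) (a b c k : R) :
  0 < c -> 0 <= k -> a ^+ 2 * c <= k ^+ 2 * b ^+ 2 -> 0 <= b ->
  a <= k * (b / Num.sqrt c).
Proof.
move=> c0 k0 abc b0; have sc : 0 < Num.sqrt c by rewrite sqrtr_gt0.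
rewrite mulrA ler_pdivlMr//; apply: le_trans (ler_norm _) _.
rewrite -(@ler_pXn2r _ 2)// ?nnegrE ?mulr_ge0// real_normK ?num_real//.
by rewrite !exprMn sqr_sqrtr// ltW.
Qed.

(** * Lower bound on the transient load *)

Theorem theorem10 (R : realType) :
  exists C : R, 0 < C /\
    forall (n : nat) (e : rel 'I_n) (alpha : 'I_n -> 'I_n -> R)
      (s : 'I_n -> R) (m lambda : R)
      (x : nat -> 'I_n -> R) (y : nat -> 'I_n -> 'I_n -> R),
      (2 <= n)%N ->
      network e alpha s ->
      lambda = second_eigenvalue (diffusion_mx e alpha s) ->
      lambda < 1 ->
      (forall i, 0 <= x 0%N i) ->
      \sum_i x 0%N i = m ->
      continuous_SOS e alpha s (beta_opt lambda) x y ->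
      forall (i : 'I_n) (t : nat),
        transient e (x t) (y t) i >=
        - (C * (Num.sqrt n%:R * deviation s m (x 0%N) / Num.sqrt (1 - lambda))).
Proof.
(* [12 = 3 + 9]: 3 for the load deficit, 9 for the outflow. *)
exists 12; split=> // n e alpha s m lam x y n2 G lamE lam1 x0 xm XY i t.
have n0 : (0 < n)%N by apply: ltnW.
have [P [d [d_le PL Pdot]]] := diffusion_frame n0 (speed_gt0 G)
  (laplacian_sym G) (laplacian_const G) lamE lam1.
pose u t : 'cV[R]_n := \col_i (x t i / s i - m / \sum_k s k).
pose w := SOS_potential (beta_opt lam) u.
have su t' : \sum_i s i * u t' i 0 = 0 by exact: (SOS_balance G n0 xm XY).
have sw t' : \sum_i s i * w t' i 0 = 0 by exact: (SOS_potential_balance G n0 xm XY).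
have uS t' : u t'.+1 = u t' - invmx (speed_mx s) *m laplacian e alpha *m w t'.
  exact: (SOS_loadE G m XY).
pose c k t := (P *m u t) k 0; pose h k t := (P *m w t) k 0.
have cS k t' : c k t'.+1 = c k t' - (1 - d k) * h k t'.
  by rewrite /c /h uS mulmxBr -PL [LHS]mxE [X in _ + X]mxE.
have hS k t' : h k t'.+1 = (beta_opt lam - 1) * h k t' + beta_opt lam * c k t'.+1.
  by rewrite /h /w /= mulmxDr -!scalemxAr [LHS]mxE [X in X + _]mxE [X in _ + X]mxE.
have c_le k t' : `|c k t'| <= 3 * `|c k 0%N|.
  exact: (@SOS_mode_bound _ lam (d k) (c k) (h k)).
set Dev := deviation s m (x 0%N); pose E0 := \sum_k c k 0%N ^+ 2.
have lam0 : 0 < 1 - lam by rewrite subr_gt0.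
have Dev0 : 0 <= Dev by exact: bigmax_ge_id.
have bn0 : 0 <= Num.sqrt n%:R * Dev by rewrite mulr_ge0 ?sqrtr_ge0.
have E0_le : E0 <= (Num.sqrt n%:R * Dev) ^+ 2.
  rewrite exprMn sqr_sqrtr// /E0.
  under eq_bigr => k _ do rewrite expr2.
  rewrite Pdot// mulr_natl -[X in _ *+ X]card_ord -sumr_const; apply: ler_sum => j _.
  have sj := speed_ge1 G j.
  (* Since [s j >= 1], the weight [s j] may be replaced by its square, which gives the squared load
     deviation. *)
  apply: (@le_trans _ _ ((s j * u 0%N j 0) ^+ 2)).
    by rewrite -mulrA -expr2 exprMn ler_wpM2r ?sqr_ge0// expr2 ler_peMr// (le_trans _ sj).
  rewrite (speed_load G) -real_normK ?num_real// ler_pXn2r ?nnegrE//.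
  exact: (le_bigmax _ (fun i => `|x 0%N i - balanced s m i|)).
have load_ge : balanced s m i - x t i <=
    3 * (Num.sqrt n%:R * Dev / Num.sqrt (1 - lam)).
  apply: le_sqrt_quotient => //; rewrite -sqrrN opprB -(speed_load G).
  apply: le_trans (frame_coordinate_le G lam1 d_le PL Pdot i (su t)) _.
  apply: (@le_trans _ _ (3 ^+ 2 * E0)); last by rewrite ler_wpM2l ?exprn_ge0.
  rewrite mulr_sumr; apply: ler_sum => k _; rewrite -exprMn.
  rewrite -real_normK ?num_real// -[leRHS]real_normK ?num_real//.
  by rewrite ler_pXn2r ?nnegrE// normrM normr_nat; exact: c_le.
have flow_le : \sum_(j | e i j && (0 < y t i j)) y t i j <=
    9 * (Num.sqrt n%:R * Dev / Num.sqrt (1 - lam)).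
  apply: le_sqrt_quotient => //.
  have -> : \sum_(j | e i j && (0 < y t i j)) y t i j =
      \sum_(j | e i j && (0 < y t i j)) alpha i j * (w t i 0 - w t j 0).
    by apply: eq_bigr => j /andP[eij _]; rewrite (SOS_flowE m XY).
  (* The outflow bound contributes 2 and [step_sqr] contributes [36 = (3 + 3) ^+ 2]; their product
     72 is rounded up to 81. *)
  apply: (@le_trans _ _ (9 ^+ 2 * E0)); last by rewrite ler_wpM2l ?exprn_ge0.
  apply: le_trans (ler_wpM2r (ltW lam0) (outflow_sqr_le G (w t) _ i)) _.
  rewrite -(frame_energy G PL Pdot (sw t)) mulrAC.
  rewrite !mulr_sumr; apply: ler_sum => k _; rewrite -/(h k t).
  have gap : 1 - lam <= 1 - d k by exact: gap_le.
  have step_le : `|c k t - c k t.+1| <= 6 * `|c k 0%N|.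
    rewrite (le_trans (ler_normB _ _))//.
    by have := c_le k t; have := c_le k t.+1; lra.
  have step_sqr : ((1 - d k) * h k t) ^+ 2 <= 36 * c k 0%N ^+ 2.
    have -> : (1 - d k) * h k t = c k t - c k t.+1 by rewrite cS; ring.
    rewrite -real_normK ?num_real// -[c k 0%N ^+ 2]real_normK ?num_real//.
    rewrite (_ : 36 = 6 ^+ 2) -?exprMn ?ler_pXn2r ?nnegrE ?mulr_ge0//; ring.
  (* One factor [1 - d k] is traded for the spectral gap, so the energy is controlled by the
     increments of [c]. *)
  have gap_sqr : (1 - lam) * ((1 - d k) * h k t ^+ 2) <= ((1 - d k) * h k t) ^+ 2.
    rewrite exprMn expr2 -mulrA ler_wpM2r// mulr_ge0 ?sqr_ge0//.
    exact: ltW (lt_le_trans lam0 gap).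
  have := sqr_ge0 (c k 0%N); lra.
(* The transient load is at least the balanced load minus the two errors; nonnegative initial loads
   let the balanced load be dropped. *)
have balanced_ge0 : 0 <= balanced s m i.
  rewrite divr_ge0 ?mulr_ge0 ?(ltW (speed_gt0 G i)) ?(ltW (speed_sum_gt0 G n0))//.
  by rewrite -xm sumr_ge0.
rewrite /transient; lra.
Qed.
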